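(* Assume that $f_1,\ldots,f_r$ have at most simple zeros and simple poles at $s_0$ (i.e. $\ell_j\in\{-1,0,1\}$ for all $j$), that Artin's conjecture does not hold at $s_0$, and that the characters are ordered so that, for integers $1\le p<q\le r$, one has $\ell_1,\ldots,\ell_p>0$, $\ell_{p+1},\ldots,\ell_q<0$, $\ell_{q+1}=\cdots=\ell_r=0$. Then: (1) $\mathbb F[H(s_0)]=\mathbb F[x_1,\ldots,x_p,\,x_{q+1},\ldots,x_r,\ x_jx_k\;:\;1\le j\le p,\ p+1\le k\le q]$. (2) Let $\Phi:\mathbb F[t_1,\ldots,t_p,\,t_{q+1},\ldots,t_r,\ t_{jk}\;:\;1\le j\le p,\ p+1\le k\le q]\to\mathbb F[H(s_0)]$ be the $\mathbb F$-algebra homomorphism with $\Phi(t_j)=x_j$ and $\Phi(t_{jk})=x_jx_k$. Then $$I_{H(s_0)}=\ker(\Phi)=\left(t_jt_{ik}-t_it_{jk},\ t_{jk}t_{im}-t_{jm}t_{ik}\;:\;1\le j,i\le p,\ p+1\le k,m\le q\right).$$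
   Context: Let $K/\mathbb Q$ be a finite Galois extension with Galois group $G$, let $\chi_1,\ldots,\chi_r$ be the irreducible complex characters of $G$, and let $f_j(s)=L(s,\chi_j,K/\mathbb Q)$, $1\le j\le r$, be their Artin L-functions (meromorphic on $\mathbb C$). Fix $s_0\in\mathbb C\setminus\{1\}$ and let $\ell_j:=\operatorname{ord}_{s=s_0}f_j\in\mathbb Z$ be the order of $s_0$ as a zero of $f_j$ (negative if $f_j$ has a pole at $s_0$). Artin's conjecture at $s_0$ is the statement that $f_1,\ldots,f_r$ are all holomorphic at $s_0$; if it fails, some $\ell_j$ is negative and some $\ell_j$ is positive (because the Dedekind zeta function $\zeta_K=\prod_j f_j^{\chi_j(1)}$ is holomorphic at $s_0$), so an ordering as in the claim exists. Let $\mathbb F$ be a field with $\mathbb C\subseteq\mathbb F\subseteq\mathcal M_{<1}$, where $\mathcal M_{<1}$ is the field of meromorphic functions on $\mathbb C$ of order $<1$. Let $H(s_0)$ be the set of $(a_1,\ldots,a_r)\in\mathbb N^r$ (with $0\in\mathbb N$) such that $f_1^{a_1}\cdots f_r^{a_r}$ is holomorphic at $s_0$, i.e. $H(s_0)=\{a\in\mathbb N^r: a_1\ell_1+\cdots+a_r\ell_r\ge 0\}$. Let $\mathbb F[H(s_0)]\subseteq\mathbb F[x_1,\ldots,x_r]$ be the $\mathbb F$-subalgebra spanned by the monomials $x_1^{a_1}\cdots x_r^{a_r}$ with $(a_1,\ldots,a_r)\in H(s_0)$. The toric ideal $I_{H(s_0)}$ is the kernel of the $\mathbb F$-algebra epimorphism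 from a polynomial ring onto $\mathbb F[H(s_0)]$ sending the variables bijectively to the minimal monomial generators of $\mathbb F[H(s_0)]$. *)

(* Defs.v *)
From HB Require Import structures.
From mathcomp Require Import all_boot all_order all_fingroup all_algebra.
From mathcomp Require Import falgebra fieldext galois mxrepresentation complex.
From mathcomp Require Import all_classical all_reals all_analysis.
From mathcomp Require mpoly.
(* The notations of mpoly are incompatible with those of MathComp-Analysis:
   [mpoly n F] is the polynomial ring over F in n variables, [multinom n] the
   type of exponent vectors, [mpolyX F m] the monomial of exponent m and
   [mnm1 i] the i-th unit vector. *)
Import -(notations) mpoly.

Set Implicit Arguments.
Unset Strict Implicit.
Unset Printing Implicit Defensive.

Import Order.TTheory GRing.Theory Num.Theory numFieldNormedType.Exports.

Local Open Scope classical_set_scope.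
Local Open Scope ring_scope.
Local Open Scope complex_scope.

(* R[i]^o is R[i] with its topology; derivability at w in direction 1 over the
   field R[i] is complex differentiability. *)
Notation CC R := (R[i]^o).

Section Meromorphic.
Variable R : realType.
Implicit Types (f g : CC R -> CC R) (z : CC R).

Definition holomorphic_near g z := \forall w \near z, derivable g w 1.

(* Meromorphic functions are represented by total functions whose values on a
   discrete set are irrelevant: poles and removable singularities carry
   arbitrary values, and only punctured neighbourhoods are inspected. *)
Definition mero_eq f g := forall z, \forall w \near z^', f w = g w.

Definition holomorphic_at f z :=
  exists2 g, holomorphic_near g z & \forall w \near z^', f w = g w.

Definition meromorphic f := forall z, exists (n : int) g,
  holomorphic_near g z /\ \forall w \near z^', f w = (w - z) ^ n * g w.

Definition order_at f z (n : int) := exists g,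
  [/\ holomorphic_near g z, g z != 0 &
      \forall w \near z^', f w = (w - z) ^ n * g w].

Definition cexp (z : R[i]) : R[i] :=
  (expR (complex.Re z))%:C * (cos (complex.Im z) +i* sin (complex.Im z)).

Definition cabs (z : R[i]) : R := complex.Re `|z|.

Definition ln_plus (x : R) : R := Num.max 0 (ln x).

Definition pole_order f z : nat :=
  xget 0%N [set k : nat | order_at f z (- k%:Z)].

Definition pole_count f (t : R) : nat :=
  (\sum_(z \in [set z : CC R | (cabs z <= t)%R]) pole_order f z)%N.

Definition nevanlinna_m f (r : R) : R :=
  (2 * pi)^-1 * \int[lebesgue_measure]_(t in `[0, 2 * pi])
                   ln_plus (cabs (f (r%:C * cexp (0 +i* t)))).

Definition nevanlinna_N f (r : R) : R :=
  \int[lebesgue_measure]_(t in `]0, r])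
     (((pole_count f t)%:R - (pole_count f 0)%:R) / t)
  + (pole_count f 0)%:R * ln r.

Definition nevanlinna_T f r := nevanlinna_m f r + nevanlinna_N f r.

Definition growth_order f : \bar R :=
  limf_esup (fun r : R => (ln_plus (nevanlinna_T f r) / ln r)%:E)
            (pinfty_nbhs R).

(* ev identifies the field F with a field of meromorphic functions of order
   < 1 which contains the constants. Injectivity up to mero_eq is automatic,
   since F is a field and 1 is sent to the constant 1. *)
Record field_of_mero_lt1 (F : fieldType) (ev : F -> CC R -> CC R) : Prop := {
  ev_meromorphic : forall a, meromorphic (ev a);
  ev_order_lt1 : forall a, (growth_order (ev a) < 1%:E)%E;
  ev_add : forall a b, mero_eq (ev (a + b)) (fun s => ev a s + ev b s);
  ev_mul : forall a b, mero_eq (ev (a * b)) (fun s => ev a s * ev b s);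
  ev_const : forall c : CC R, exists a, mero_eq (ev a) (fun=> c) }.

End Meromorphic.

Section ArtinLFunction.
Variables (R : realType) (K : splittingFieldType rat).
Local Notation G := 'Gal({:K} / 1%AS)%G.
Implicit Types (P : set K) (s : gal_of {:K}) (chi : gal_of {:K} -> R[i]).

Definition integers : set K := [set x | integralOver (intr : int -> K) x].

Record prime_over (p : nat) P : Prop := {
  prime_over_sub : P `<=` integers;
  prime_over_add : forall x y, P x -> P y -> P (x + y);
  prime_over_mul : forall x y, integers x -> P y -> P (x * y);
  prime_over_proper : ~ P 1;
  prime_over_prime : forall x y, integers x -> integers y ->
    P (x * y) -> P x \/ P y;
  prime_over_p : P p%:R }.

Definition inertia P : {set gal_of {:K}} :=
  [set s in G | `[< forall x, integers x -> P (s x - x) >]].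

Definition frobenius (p : nat) P s :=
  s \in G /\ forall x, integers x -> P (s x - x ^+ p).

(* In MathComp the Galois group is multiplied in the order (s * t) x = t (s x)
   and matrices act on the right of row vectors; both reversals cancel, so
   the row space is the usual left module of a representation of the Galois
   group. rfix_mx is the subspace fixed by inertia, and restrictmx the matrix
   of the Frobenius acting on it. *)
Definition euler_factor n (rho : mx_representation R[i] G n) P s (x : R[i]) :
    R[i] :=
  (\det (1%:M - x *: restrictmx (rfix_mx rho (inertia P)) (rho s)))^-1.

Definition affords n (rho : mx_representation R[i] G n) chi :=
  forall s, chi s = \tr (rho s).

Definition irr_character chi := exists n (rho : mx_representation R[i] G n),
  mx_irreducible rho /\ affords rho chi.

Definition irr_characters r (chi : 'I_r -> gal_of {:K} -> R[i]) :=
  [/\ forall j, irr_character (chi j), injective chi &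
      forall c, irr_character c -> exists j, c = chi j].

(* f is the meromorphic continuation of the Euler product of chi. The Euler
   factors depend neither on rho nor on the chosen primes P p above p and
   Frobenius elements s p. *)
Definition artin_L_function chi (f : CC R -> CC R) :=
  meromorphic f /\
  exists n (rho : mx_representation R[i] G n) (P : nat -> set K)
         (s : nat -> gal_of {:K}),
    [/\ affords rho chi,
        forall p, prime p -> prime_over p (P p) /\ frobenius p (P p) (s p) &
        forall z : CC R, 1 < complex.Re z ->
          (fun N : nat => \prod_(p < N | prime p)
             euler_factor rho (P p) (s p) (cexp (- (z * (ln p%:R)%:C)))
             : CC R) @ \oo --> f z].

End ArtinLFunction.

Definition hol_monoid (R : realType) r (f : 'I_r -> CC R -> CC R) (s0 : CC R) :
    set (multinom r) :=
  [set a | holomorphic_at (fun s => \prod_(j < r) f j s ^+ a j) s0].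

Notation mvar F i := (mpolyX F (mnm1 i)).

Section Algebra.
Variable F : fieldType.

Definition monoid_algebra r (H : set (multinom r)) : set (mpoly r F) :=
  [set P | exists (ms : seq (multinom r)) (c : multinom r -> F),
     (forall m, m \in ms -> H m) /\ P = \sum_(m <- ms) c m *: mpolyX F m].

Definition gen_subalg r (S : set (mpoly r F)) : set (mpoly r F) :=
  smallest [set A : set (mpoly r F) | GRing.subalg_closed [in A]] S.

Definition is_ideal n (I : set (mpoly n F)) :=
  I 0 /\ forall a u v, I u -> I v -> I (a * u + v).

Definition gen_ideal n (S : set (mpoly n F)) : set (mpoly n F) :=
  smallest (@is_ideal n) S.

Definition mpoly_ker n r (Psi : mpoly n F -> mpoly r F) : set (mpoly n F) :=
  [set P | Psi P = 0].

Definition minimal_monomial_generators r (A : set (mpoly r F))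
    (M : set (multinom r)) :=
  gen_subalg (mpolyX F @` M) = A /\
  forall M', M' `<=` M -> gen_subalg (mpolyX F @` M') = A -> M' = M.

(* The toric ideal of H is mpoly_ker Psi, for any Psi as follows. *)
Definition toric_epimorphism r (H : set (multinom r)) n
    (Psi : {lrmorphism mpoly n F -> mpoly r F}) :=
  range Psi = monoid_algebra H /\
  exists u : 'I_n -> multinom r,
    [/\ injective u, forall i, Psi (mvar F i) = mpolyX F (u i) &
        minimal_monomial_generators (monoid_algebra H) (range u)].

Definition toric_ideal r (H : set (multinom r)) n (I : set (mpoly n F)) :=
  exists Psi : {lrmorphism mpoly n F -> mpoly r F},
    toric_epimorphism H Psi /\ I = mpoly_ker Psi.

End Algebra.

Arguments monoid_algebra F {r} H.

Section Variables.
Variables (F : fieldType) (p q r : nat).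

(* Indices are 0-based: j < p, p <= j < q and q <= j are the indices of the
   zeros, of the poles, and of the functions of order 0. *)
Definition zeros := {j : 'I_r | j < p}%N.
Definition poles := {j : 'I_r | p <= j < q}%N.
Definition units := {j : 'I_r | q <= j}%N.

Definition tvar : finType := (zeros + units + zeros * poles)%type.

Definition t_zero (j : zeros) : mpoly #|tvar| F :=
  mvar F (enum_rank (inl (inl j) : tvar)).
Definition t_unit (j : units) : mpoly #|tvar| F :=
  mvar F (enum_rank (inl (inr j) : tvar)).
Definition t_pair (j : zeros) (k : poles) : mpoly #|tvar| F :=
  mvar F (enum_rank (inr (j, k) : tvar)).

Definition tvar_image (v : tvar) : mpoly r F :=
  match v with
  | inl (inl j) => mvar F (val j)
  | inl (inr j) => mvar F (val j)
  | inr (j, k) => mvar F (val j) * mvar F (val k)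
  end.

Definition Phi : {lrmorphism mpoly #|tvar| F -> mpoly r F} :=
  comp_mpoly [tuple tvar_image (enum_val i) | i < #|tvar|].

Definition toric_relations : set (mpoly #|tvar| F) :=
  [set P | exists j i k, P = t_zero j * t_pair i k - t_zero i * t_pair j k] `|`
  [set P | exists j i k m,
     P = t_pair j k * t_pair i m - t_pair j m * t_pair i k].

End Variables.

Arguments t_zero F {p q r} j.
Arguments t_unit F {p q r} j.
Arguments t_pair F {p q r} j k.
Arguments toric_relations F p q r : clear implicits.

(* Main.v *)
Require Import Defs.
From mathcomp Require Import all_boot all_order all_fingroup all_algebra.
From mathcomp Require Import falgebra fieldext galois mxrepresentation complex.
From mathcomp Require Import all_classical all_reals all_analysis.
From mathcomp Require mpoly.
From mathcomp Require Import zify.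
Import -(notations) mpoly.
Import Order.TTheory GRing.Theory Num.Theory numFieldNormedType.Exports.
Local Open Scope classical_set_scope.
Local Open Scope ring_scope.
Local Open Scope complex_scope.

(** The order of vanishing at s0 is additive, and a product of powers of the
f_j is holomorphic at s0 exactly when its order is nonnegative. Hence H(s0) is
the set of exponents a whose weight, the sum of the a_j * l_j, is nonnegative
([hol_monoidE]), and by hypothesis each l_j is 1, -1 or 0.

Part (1). Call the exponents of x_j for j a zero or a unit, and of x_j x_k for
j a zero and k a pole, the generators. Any a in H(s0) is a sum of generators,
by induction on the degree: remove a unit if there is one; otherwise, if a
pole k occurs, nonnegativity of the weight forces some zero j to occur, and
removing both leaves the weight unchanged; otherwise only zeros are left
([range_img]). A monomial morphism has as image both the span of the monomials
whose exponent is a combination of the generators and the subalgebra they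
generate ([range_monomial_morphism], [range_monomial_morphism_gen]). The
generators form a minimal system because each of them is irreducible in H(s0)
and removing an irreducible element from a monoid leaves a submonoid
([irreducible_tvar_exp], [minimal_generators_irreducible]).

Part (2). The kernel of a monomial morphism lies in every ideal that contains
all binomials t^u - t^v with u and v of equal image
([monomial_morphism_ker_sub]). For such u and v, the relations allow u and v
to be rewritten so as to share a variable ([common_variable]): if t_jk divides
t^u, then the pole k and the zero j both occur in the image of v, so either
t_jk divides t^v already, or t^v is divisible by some t_ik and by t_j or some
t_jm, and one relation produces t_jk; if no pair variable occurs in u or v,
then u and v have literally the same variables. Cancelling the shared variable
lowers the degree of the image, and induction concludes
([toric_binomials]). *)

Set Implicit Arguments.
Unset Strict Implicit.
Unset Printing Implicit Defensive.

(** * Orders of vanishing and holomorphy *)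

(** Differentiation facts on K^o for an abstract field K. They are stated
before K is specialised to the complex numbers because the normed module
structures of K and of K^o are cheap to identify for an abstract K, while
unfolding them over R[i] is intractable. *)
Section NumFieldDerivable.
Context {K : numFieldType}.
Implicit Types (f g : K^o -> K^o) (z : K^o).

Lemma regular_derivableM {f g z} :
  derivable f z 1 -> derivable g z 1 -> derivable (fun w => f w * g w) z 1.
Proof. exact: (@derivableM K K^o f g z 1). Qed.

Lemma regular_derivable_subX (n : nat) z w :
  derivable (fun x : K^o => (x - z) ^+ n : K^o) w 1.
Proof.
elim: n => [|n IHn]; first exact: derivable_cst.
rewrite (_ : (fun _ => _) = fun x => (x - z) * (x - z) ^+ n); last first.
  by apply/funext => x; rewrite exprS.
apply: regular_derivableM IHn.
by apply: derivableB; [exact: derivable_id|exact: derivable_cst].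
Qed.

Lemma regular_derivable_cvg {g z} : derivable g z 1 -> g w @[w --> z^'] --> g z.
Proof.
move=> dg; apply/continuous_withinNx.
exact/differentiable_continuous/derivable1_diffP.
Qed.

Lemma regular_cvg_dnbhs_unique {f g z} {a b : K^o} :
  (\forall w \near z^', f w = g w) ->
  f w @[w --> z^'] --> a -> g w @[w --> z^'] --> b -> a = b.
Proof.
move=> fg fa gb; apply: (@cvg_unique K^o (@norm_hausdorff _ _) _ _ _ _ _ gb).
exact: cvg_trans (near_eq_cvg fg) fa.
Qed.

Lemma regular_near_neq z : \forall w \near z^', w - z != 0.
Proof.
by near=> w; rewrite subr_eq0; near: w; exact: nbhs_dnbhs_neq.
Unshelve. all: by end_near. Qed.

End NumFieldDerivable.

Section OrderAt.
Context {R : realType}.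
Implicit Types (f g : CC R -> CC R) (z : CC R).

Lemma holomorphic_nearM {f g z} :
  holomorphic_near f z -> holomorphic_near g z ->
  holomorphic_near (fun w => f w * g w) z.
Proof. by apply: filterS2 => w; exact: regular_derivableM. Qed.

Lemma holomorphic_near_cst (c : CC R) z : holomorphic_near (fun=> c) z.
Proof.
by near=> w; exact: derivable_cst.
Unshelve. all: by end_near. Qed.

Lemma holomorphic_near_subX z (n : nat) :
  holomorphic_near (fun w => (w - z) ^+ n) z.
Proof.
by near=> w; exact: regular_derivable_subX.
Unshelve. all: by end_near. Qed.

Lemma holomorphic_near_cvg {g z} :
  holomorphic_near g z -> g w @[w --> z^'] --> g z.
Proof. by move=> /nbhs_singleton; exact: regular_derivable_cvg. Qed.

Lemma order_at_cst1 z : order_at (fun=> 1) z 0.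
Proof.
exists (fun=> 1); split; first exact: holomorphic_near_cst.
  exact: oner_neq0.
by near=> w; rewrite expr0z mul1r.
Unshelve. all: by end_near. Qed.

Lemma order_atM {f g z m n} :
  order_at f z m -> order_at g z n ->
  order_at (fun w => f w * g w) z (m + n).
Proof.
move=> [f1 [hf f1z ef]] [g1 [hg g1z eg]].
exists (fun w => f1 w * g1 w); split; [exact: holomorphic_nearM|exact: mulf_neq0|].
apply: filterS3 (@regular_near_neq R[i] z) ef eg => w wz -> ->.
by rewrite expfzDr// mulrACA.
Qed.

Lemma order_at_prod {I : Type} (s : seq I) {f : I -> CC R -> CC R} {z}
    {l : I -> int} (a : I -> nat) :
  (forall i, order_at (f i) z (l i)) ->
  order_at (fun w => \prod_(i <- s) f i w ^+ a i) z
    (\sum_(i <- s) (a i)%:Z * l i).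
Proof.
move=> fl.
have flX i n : order_at (fun w => f i w ^+ n) z (n%:Z * l i).
  elim: n => [|n IHn]; first by rewrite mul0r; exact: order_at_cst1.
  rewrite intS mulrDl mul1r.
  rewrite (_ : (fun _ => _) = fun w => f i w * f i w ^+ n); last first.
    by apply/funext => w; rewrite exprS.
  exact: order_atM.
elim: s => [|i s IHs].
  rewrite big_nil (_ : (fun _ => _) = fun=> 1); first exact: order_at_cst1.
  by apply/funext => w; rewrite big_nil.
rewrite big_cons (_ : (fun _ => _) =
    fun w => f i w ^+ a i * \prod_(j <- s) f j w ^+ a j).
  exact: order_atM.
by apply/funext => w; rewrite big_cons.
Qed.

(** If the order were negative, a holomorphic extension times a positive power
of w - z would tend both to 0 and to the nonzero value g z. *)
Lemma order_at_holomorphic {f z n} :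
  order_at f z n -> holomorphic_at f z <-> 0 <= n.
Proof.
move=> [g [hg gz fg]]; split; last first.
  case: n fg => [n|n] fg n0; last by case: (notF n0).
  exists (fun w => (w - z) ^+ n * g w); last exact: fg.
  exact: holomorphic_nearM (holomorphic_near_subX z n) hg.
case=> h hh fh; case: n fg => [n|n] fg; first by rewrite lez_nat.
have gE : \forall w \near z^', (w - z) ^+ n.+1 * h w = g w.
  apply: filterS3 (@regular_near_neq R[i] z) fg fh => w wz -> <-.
  by rewrite NegzE -exprnN mulrA mulfV ?mul1r// expf_neq0.
have hk := holomorphic_nearM (holomorphic_near_subX z n.+1) hh.
have := @regular_cvg_dnbhs_unique R[i] _ _ _ _ _ gE
  (holomorphic_near_cvg hk) (holomorphic_near_cvg hg).
by rewrite subrr expr0n/= mul0r => g0z; rewrite -g0z eqxx in gz.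
Qed.

End OrderAt.

Lemma hol_monoidE (R : realType) r (f : 'I_r -> CC R -> CC R) (s0 : CC R)
    (l : 'I_r -> int) :
  (forall j, order_at (f j) s0 (l j)) ->
  hol_monoid f s0 = [set a | 0 <= \sum_j (a j)%:Z * l j].
Proof.
move=> fl; have ordP (a : multinom r) := order_at_holomorphic
  (order_at_prod (index_enum _) (fun j => a j) fl).
by apply/seteqP; split=> a; [exact: (ordP a).1|exact: (ordP a).2].
Qed.

(** * Polynomials with support in a monoid of exponents *)

(** Addition of exponent vectors. *)
Local Notation "a +m b" := (mnm_add a b) (at level 50, left associativity).

Lemma mnm_addI n (a b c : multinom n) : a +m b = a +m c -> b = c.
Proof.
by move=> /mnmP abc; apply/mnmP => i; apply: (@addnI (a i)); rewrite -!mnmDE.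
Qed.

Lemma mnm1_split n (u : multinom n) i :
  (0 < u i)%N -> exists u', u = mnm1 i +m u'.
Proof.
move=> ui; exists (mnm_sub u (mnm1 i)); apply/mnmP => j.
rewrite mnmDE mnmBE mnm1E; case: eqP => [<-|_]; last by rewrite add0n subn0.
by rewrite subnKC.
Qed.

Lemma mnm_neq0 n (u : multinom n) : u <> mnm0 -> exists i, (0 < u i)%N.
Proof.
move=> u0; apply: contrapT => /forallNP u_eq0; apply: u0.
by apply/mnmP => i; rewrite mnm0E; apply/eqP; rewrite -leqn0 leqNgt; apply/negP.
Qed.

(** Submonoids of N^n. *)
Record is_submonoid n (H : set (multinom n)) : Prop := {
  submonoid0 : H mnm0;
  submonoidD : forall a b, H a -> H b -> H (a +m b) }.

(** The irreducible elements (atoms) of a monoid H of exponents, whose only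
unit is 0. *)
Definition is_irreducible n (H : set (multinom n)) (m : multinom n) :=
  [/\ H m, m <> mnm0 &
      forall a b, H a -> H b -> m = a +m b -> a = mnm0 \/ b = mnm0].

Section MonoidAlgebra.
Context {F : fieldType} {r : nat}.
Implicit Types (H M : set (multinom r)) (A : set (mpoly r F)).

(** The monoid algebra of H consists of the polynomials with support in H. *)
Lemma monoid_algebraP H (P : mpoly r F) :
  monoid_algebra F H P <-> forall m, mcoeff m P != 0 -> H m.
Proof.
split=> [[ms [c [msH ->]]] m|PH].
  rewrite raddf_sum/=; apply: contra_neqP => Hm.
  rewrite big_seq big1// => k kms; rewrite mcoeffZ mcoeffX.
  by case: eqP => [km|_]; [case: Hm; rewrite -km; exact: msH|rewrite mulr0].
exists (msupp P), (fun m => mcoeff m P); split; last exact: mpolyE.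
by move=> m; rewrite mcoeff_msupp; exact: PH.
Qed.

Lemma monoid_algebraX H m : monoid_algebra F H (mpolyX F m) <-> H m.
Proof.
split=> [/monoid_algebraP|Hm]; first by apply; rewrite mcoeffX eqxx oner_neq0.
apply/monoid_algebraP => k; rewrite mcoeffX.
by case: (m =P k) => [<-|]; rewrite ?eqxx.
Qed.

Lemma subalg_monoid_algebra H :
  is_submonoid H -> GRing.subalg_closed [in monoid_algebra F H].
Proof.
move=> [H0 HD]; split; first by rewrite -mpolyX0; apply/mem_set/monoid_algebraX.
- move=> a u v /set_mem /monoid_algebraP uH /set_mem /monoid_algebraP vH.
  apply/mem_set/monoid_algebraP => m; rewrite mcoeffD mcoeffZ.
  have [u0|/uH//] := eqVneq (mcoeff m u) 0.
  by rewrite u0 mulr0 add0r => /vH.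
- move=> u v /set_mem /monoid_algebraP uH /set_mem /monoid_algebraP vH.
  apply/mem_set/monoid_algebraP => m; apply: contra_neqP => Hm.
  rewrite (mpolyE u) (mpolyE v) big_distrl raddf_sum/=.
  rewrite big_seq big1// => i iu; rewrite big_distrr raddf_sum/=.
  rewrite big_seq big1// => j jv.
  rewrite -scalerAl -scalerAr scalerA -mpolyXD mcoeffZ mcoeffX.
  case: eqP => [ijm|_]; last by rewrite mulr0.
  by case: Hm; rewrite -ijm; apply: HD; [apply: uH|apply: vH];
     rewrite -mcoeff_msupp.
Qed.

(** Closure of a subalgebra under linear combinations and monomials. *)
Section SubalgClosed.
Context {A : set (mpoly r F)}.
Hypothesis Aalg : GRing.subalg_closed [in A].

Lemma subalg_sum (I : eqType) (s : seq I) (c : I -> F) (P : I -> mpoly r F) :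
  (forall i, i \in s -> A (P i)) -> A (\sum_(i <- s) c i *: P i).
Proof.
case: Aalg => A1 Alin _ AP.
elim: s AP => [|i s IHs] AP.
  rewrite big_nil; apply/set_mem.
  by have := Alin (-1) _ _ A1 A1; rewrite scaleN1r addNr.
rewrite big_cons; apply/set_mem/Alin; apply/mem_set.
  by apply: AP; rewrite mem_head.
by apply: IHs => j js; apply: AP; rewrite in_cons js orbT.
Qed.

Lemma subalg_prod_exp (I : Type) (s : seq I) (P : I -> mpoly r F)
    (e : I -> nat) :
  (forall i, A (P i)) -> A (\prod_(i <- s) P i ^+ e i).
Proof.
case: Aalg => A1 _ AM AP.
apply: (big_ind A); first exact: set_mem.
  by move=> x y Ax Ay; apply/set_mem/AM; exact/mem_set.
move=> i _; elim: (e i) => [|k IHk]; first exact/set_mem.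
by rewrite exprS; apply/set_mem/AM; exact/mem_set.
Qed.

End SubalgClosed.

(** A generating system made of irreducible elements is minimal: if m were
dropped, the generated subalgebra would have its support in H minus m. *)
Lemma minimal_generators_irreducible H M :
  is_submonoid H -> M `<=` is_irreducible H ->
  gen_subalg (mpolyX F @` M) = monoid_algebra F H ->
  minimal_monomial_generators (monoid_algebra F H) M.
Proof.
move=> Hmon Mirr genM; split=> // M' M'M genM'.
apply/seteqP; split=> // m Mm; apply: contrapT => M'm.
have [Hm m0 mirr] := Mirr _ Mm.
(* The complement of an irreducible element is a submonoid. *)
pose S := [set a | H a /\ a <> m].
have Smon : is_submonoid S.
  split=> [|a b [Ha am] [Hb bm]]; first by split; [exact: submonoid0|exact/nesym].
  split; first exact: submonoidD.
  move=> /esym abm; have [a0|b0] := mirr _ _ Ha Hb abm.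
    by apply: bm; rewrite abm a0 add0m.
  by apply: am; rewrite abm b0 addm0.
have : monoid_algebra F S (mpolyX F m).
  have : monoid_algebra F H (mpolyX F m) by apply/monoid_algebraX.
  rewrite -genM'; apply: smallest_sub; first exact: subalg_monoid_algebra.
  move=> _ [k M'k <-]; apply/monoid_algebraX; split.
    by have [] := Mirr _ (M'M _ M'k).
  by move=> km; apply: M'm; rewrite -km.
by move=> /monoid_algebraX [].
Qed.

End MonoidAlgebra.

(** * Monomial morphisms *)
Section MonomialMorphism.
Context {F : fieldType} {n r : nat} (w : 'I_n -> multinom r).

(** The exponent of the image of t^u under the morphism sending the i-th
variable to x^(w i): the combination of the w i with coefficients u i. *)
Definition mnm_comb (u : multinom n) : multinom r :=
  Multinom [tuple (\sum_i u i * w i j)%N | j < r].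

Lemma mnm_combE u j : mnm_comb u j = (\sum_i u i * w i j)%N.
Proof. exact: mnmE. Qed.

Lemma mnm_comb0 : mnm_comb mnm0 = mnm0.
Proof.
by apply/mnmP => j; rewrite mnm_combE mnm0E big1// => i _; rewrite mnm0E.
Qed.

Lemma mnm_combD u v : mnm_comb (u +m v) = mnm_comb u +m mnm_comb v.
Proof.
apply/mnmP => j; rewrite mnmDE !mnm_combE -big_split.
by apply: eq_bigr => i _; rewrite mnmDE mulnDl.
Qed.

Lemma mnm_comb1 i : mnm_comb (mnm1 i) = w i.
Proof.
apply/mnmP => j; rewrite mnm_combE (bigD1 i)//= mnm1E eqxx mul1n.
rewrite big1 ?addn0// => k ki.
by rewrite mnm1E eq_sym (negbTE ki).
Qed.

Lemma submonoid_range_mnm_comb : is_submonoid (range mnm_comb).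
Proof.
split; first by exists mnm0; rewrite ?mnm_comb0.
by move=> _ _ [u _ <-] [v _ <-]; exists (u +m v); rewrite ?mnm_combD.
Qed.

Lemma mnm_comb_gt0 u j :
  (0 < mnm_comb u j)%N -> exists i, (0 < u i)%N /\ (0 < w i j)%N.
Proof.
rewrite mnm_combE lt0n sum_nat_eq0 negb_forall.
case/existsP=> i; rewrite muln_eq0 negb_or -!lt0n.
by case/andP=> ui wij; exists i.
Qed.

Context {Psi : {lrmorphism mpoly n F -> mpoly r F}}.
Hypothesis PsiX1 : forall i, Psi (mpolyX F (mnm1 i)) = mpolyX F (w i).

Lemma monomial_morphismX u : Psi (mpolyX F u) = mpolyX F (mnm_comb u).
Proof.
rewrite mpolyXE_id rmorph_prod/=.
rewrite (eq_bigr (fun i => mpolyX F (w i) ^+ u i)); last first.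
  by move=> i _; rewrite rmorphXn/= PsiX1.
rewrite mprodXnE; congr mpolyX; apply/mnmP => j.
by rewrite mnm_sumE mnm_combE; apply: eq_bigr => i _; rewrite mulmnE mulnC.
Qed.

Lemma monomial_morphismE P :
  Psi P = \sum_(m <- msupp P) mcoeff m P *: mpolyX F (mnm_comb m).
Proof.
rewrite {1}(mpolyE P) raddf_sum/=; apply: eq_bigr => m _.
by rewrite linearZ/= monomial_morphismX.
Qed.

Lemma range_monomial_morphism :
  range Psi = monoid_algebra F (range mnm_comb).
Proof.
apply/seteqP; split=> [_ [P _ <-]|P /monoid_algebraP PH].
  rewrite monomial_morphismE.
  apply: (subalg_sum (subalg_monoid_algebra submonoid_range_mnm_comb)) => m _.
  by apply/monoid_algebraX; exists m.
(* A preimage of each exponent of P; the default 0 is never used on them. *)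
pose lift (m : multinom r) : multinom n := xget mnm0 [set u | mnm_comb u = m].
exists (\sum_(m <- msupp P) mcoeff m P *: mpolyX F (lift m)) => //.
rewrite raddf_sum/= [RHS](mpolyE P) big_seq [RHS]big_seq.
apply: eq_bigr => m; rewrite mcoeff_msupp => /PH[u _ um].
rewrite linearZ/= monomial_morphismX; congr (_ *: mpolyX F _).
by rewrite /lift; case: xgetP => [x _ <-//|/(_ u)].
Qed.

Lemma range_monomial_morphism_gen :
  range Psi = gen_subalg (mpolyX F @` range w).
Proof.
apply/seteqP; split=> [_ [P _ <-] A [Aalg wA]|].
  rewrite (mpolyE P) raddf_sum/=.
  under eq_bigr do rewrite linearZ/=.
  apply: (subalg_sum Aalg) => m _.
  rewrite mpolyXE_id rmorph_prod/=.
  under eq_bigr do rewrite rmorphXn/= PsiX1.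
  by apply: (subalg_prod_exp Aalg) => i; apply: wA; exists (w i) => //; exists i.
rewrite range_monomial_morphism; apply: smallest_sub.
  exact/subalg_monoid_algebra/submonoid_range_mnm_comb.
move=> _ [_ [i _ <-] <-]; apply/monoid_algebraX.
by exists (mnm1 i); rewrite ?mnm_comb1.
Qed.

Lemma ideal_sum (I : set (mpoly n F)) (T : Type) (s : seq T)
    (c : T -> F) (P : T -> mpoly n F) :
  is_ideal I -> (forall i, I (P i)) -> I (\sum_(i <- s) c i *: P i).
Proof.
move=> [I0 ID] IP; elim/big_rec: _ => // i x _ Ix.
by rewrite -mul_mpolyC; exact: ID.
Qed.

(** Modulo I, every monomial equals the chosen representative of its fibre, and
the coefficients of P on each fibre add up to a coefficient of Psi P = 0. *)
Lemma monomial_morphism_ker_sub (I : set (mpoly n F)) :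
  is_ideal I ->
  (forall u v, mnm_comb u = mnm_comb v -> I (mpolyX F u - mpolyX F v)) ->
  mpoly_ker Psi `<=` I.
Proof.
move=> Iid Ibin P PsiP0.
pose nf m : multinom n := xget mnm0 [set u | mnm_comb u = mnm_comb m].
have nfE m : mnm_comb (nf m) = mnm_comb m.
  by rewrite /nf; case: xgetP => [x _ ->|/(_ m)[]].
have nf_comb u v : mnm_comb u = mnm_comb v -> nf u = nf v.
  by rewrite /nf => ->.
have -> : P = \sum_(m <- msupp P) mcoeff m P *: (mpolyX F m - mpolyX F (nf m)).
  under eq_bigr do rewrite scalerBr.
  rewrite big_split/= -mpolyE sumrN.
  suff -> : \sum_(m <- msupp P) mcoeff m P *: mpolyX F (nf m) = 0.
    by rewrite subr0.
  apply/mpolyP => k; rewrite raddf_sum/= mcoeff0.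
  (* Only representatives occur; at such a k the sum is over the fibre of k. *)
  have [nfk|nfk] := eqVneq (nf k) k; last first.
    rewrite big1// => m _; rewrite mcoeffZ mcoeffX.
    case: eqP => [mk|_]; last by rewrite mulr0.
    by rewrite -mk (nf_comb _ m) ?eqxx// in nfk.
  have := congr1 (mcoeff (mnm_comb k)) (PsiP0 : Psi P = 0).
  rewrite monomial_morphismE raddf_sum/= mcoeff0 => PsiPk; rewrite -[RHS]PsiPk.
  apply: eq_bigr => m _; rewrite !mcoeffZ !mcoeffX; congr (_ * _%:R).
  congr (nat_of_bool _); apply/eqP/eqP => [<-|/nf_comb ->//].
  by rewrite nfE.
by apply: ideal_sum => // m; apply: Ibin; rewrite nfE.
Qed.

End MonomialMorphism.

(** * Binomials in an ideal *)

Section Binomials.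
Context {F : fieldType} {n : nat} (I : set (mpoly n F)).
Hypothesis I_ideal : is_ideal I.

(** Congruence of monomials modulo I. *)
Definition binomial_in (u v : multinom n) := I (mpolyX F u - mpolyX F v).

Lemma binomial_in_refl u : binomial_in u u.
Proof. by rewrite /binomial_in subrr; case: I_ideal. Qed.

Lemma binomial_in_sym u v : binomial_in u v -> binomial_in v u.
Proof.
case: I_ideal => I0 ID uv; rewrite /binomial_in.
by have := ID (-1) _ _ uv I0; rewrite addr0 mulN1r opprB.
Qed.

Lemma binomial_in_trans v u t :
  binomial_in u v -> binomial_in v t -> binomial_in u t.
Proof.
case: I_ideal => _ ID uv vt; rewrite /binomial_in.
by have := ID 1 _ _ uv vt; rewrite mul1r addrA subrK.
Qed.

Lemma binomial_inDl a u v :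
  binomial_in u v -> binomial_in (a +m u) (a +m v).
Proof.
case: I_ideal => I0 ID uv; rewrite /binomial_in !mpolyXD -mulrBr.
by have := ID (mpolyX F a) _ _ uv I0; rewrite addr0.
Qed.

Lemma binomial_inDr a u v :
  binomial_in u v -> binomial_in (u +m a) (v +m a).
Proof. by rewrite ![_ +m a]addmC; exact: binomial_inDl. Qed.

End Binomials.

Lemma gen_ideal_ideal (F : fieldType) n (S : set (mpoly n F)) :
  is_ideal (gen_ideal S).
Proof.
split=> [A [[]//]|a u v Iu Iv A [Aid SA]].
by apply: Aid.2; [exact: Iu|exact: Iv].
Qed.

(** * The toric relations *)
Section ToricVariables.
Context {p q r : nat}.
Local Notation tvar := (tvar p q r).

(** The exponent of the image of a variable under Phi. *)
Definition tvar_exp (v : tvar) : multinom r :=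
  match v with
  | inl (inl j) => mnm1 (val j)
  | inl (inr j) => mnm1 (val j)
  | inr (j, k) => mnm1 (val j) +m mnm1 (val k)
  end.

(** The same on the indices of the polynomial ring, which are enumeration ranks
of variables. *)
Definition tidx_exp (i : 'I_#|tvar|) : multinom r := tvar_exp (enum_val i).

Local Notation img := (mnm_comb tidx_exp).
Local Notation U v := (mnm1 (@enum_rank tvar v)).

Lemma img_tvar v : img (U v) = tvar_exp v.
Proof. by rewrite mnm_comb1 /tidx_exp enum_rankK. Qed.

Lemma range_tidx_exp : range tidx_exp = range tvar_exp.
Proof.
apply/seteqP; split=> [_ [i _ <-]|_ [v _ <-]]; first by exists (enum_val i).
by exists (enum_rank v); rewrite // /tidx_exp enum_rankK.
Qed.

(** If x_j divides the image of t^u, then some variable of t^u accounts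
for it. *)
Lemma img_gt0 u j : (0 < img u j)%N ->
  exists v u', u = U v +m u' /\ (0 < tvar_exp v j)%N.
Proof.
case/mnm_comb_gt0 => i [ui ij].
have [u' ->] := mnm1_split ui.
by exists (enum_val i), u'; rewrite enum_valK.
Qed.

Lemma tvar_exp_gt0 (v : tvar) (j : 'I_r) : (0 < tvar_exp v j)%N ->
  match v with
  | inl (inl i) => val i = j
  | inl (inr i) => val i = j
  | inr (i, k) => val i = j \/ val k = j
  end.
Proof.
case: v => [[i|i]|[i k]]/=; rewrite ?mnmDE !mnm1E;
  do ?[by case: eqP => // ->].
by case: eqP => [->|_]; [left|case: eqP => // ->; right].
Qed.

Hypothesis le_pq : (p <= q)%N.

Lemma tvar_exp_gt0_zero (v : tvar) (j : zeros p r) :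
  (0 < tvar_exp v (val j))%N ->
  v = inl (inl j) \/ exists k, v = inr (j, k).
Proof.
move/tvar_exp_gt0; have jp := valP j; case: v => [[i|i]|[i k]].
- by move/val_inj => ->; left.
- by move=> ij; have /= := valP i; rewrite ij /= in jp *; lia.
- case=> [/val_inj ->|kj]; first by right; exists k.
  by have /= := valP k; rewrite kj /= in jp *; lia.
Qed.

Lemma tvar_exp_gt0_unit (v : tvar) (j : units q r) :
  (0 < tvar_exp v (val j))%N -> v = inl (inr j).
Proof.
move/tvar_exp_gt0; have jq := valP j; case: v => [[i|i]|[i k]].
- by move=> ij; have /= := valP i; rewrite ij /= in jq *; lia.
- by move/val_inj => ->.
- case=> ij; [have /= := valP i|have /= := valP k];
    by rewrite ij /= in jq *; lia.
Qed.

Lemma tvar_exp_gt0_pole (v : tvar) (k : poles p q r) :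
  (0 < tvar_exp v (val k))%N -> exists j, v = inr (j, k).
Proof.
move/tvar_exp_gt0; have kpq := valP k; case: v => [[i|i]|[i m]].
- by move=> ij; have /= := valP i; rewrite ij /= in kpq *; lia.
- by move=> ij; have /= := valP i; rewrite ij /= in kpq *; lia.
- case=> [ij|/val_inj ->]; last by exists i.
  by have /= := valP i; rewrite ij /= in kpq *; lia.
Qed.

Lemma tvar_exp_inj : injective tvar_exp.
Proof.
move=> u v uv.
have gt0 (w : tvar) : match w with
    | inl (inl j) => (0 < tvar_exp w (val j))%N
    | inl (inr j) => (0 < tvar_exp w (val j))%N
    | inr (j, k) => (0 < tvar_exp w (val j))%N /\ (0 < tvar_exp w (val k))%N
    end.
  by case: w => [[j|j]|[j k]]; rewrite /= ?mnmDE !mnm1E !eqxx ?addn1.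
have mdegE (w : tvar) : mdeg (tvar_exp w) = if w is inr _ then 2%N else 1%N.
  by case: w => [[j|j]|[j k]]; rewrite /= ?mdegD !mdeg1.
have := congr1 mdeg uv; rewrite !mdegE.
have := gt0 u; rewrite uv; case: u uv => [[j|j]|[j k]] uv.
- by case/tvar_exp_gt0_zero => [->//|[k ->]].
- by move/tvar_exp_gt0_unit ->.
- case=> _ /tvar_exp_gt0_pole[i iE] _; rewrite iE in uv *.
  have := gt0 (inr (j, k)); rewrite uv => -[/tvar_exp_gt0_zero + _].
  by case=> [//|[m [-> _]]].
Qed.

Lemma tidx_exp_inj : injective tidx_exp.
Proof. by move=> i j /tvar_exp_inj /enum_val_inj. Qed.

Section ToricIdeal.
Context {F : fieldType} (I : set (mpoly #|tvar| F)).
Hypotheses (I_ideal : is_ideal I) (I_rel : toric_relations F p q r `<=` I).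

(** If t_jk divides a monomial with the same image as t^v, then a single
relation turns t^v into a multiple of t_jk. *)
Lemma pair_exchange u v j k : img (U (inr (j, k)) +m u) = img v ->
  exists v', binomial_in I v (U (inr (j, k)) +m v') /\
             img (U (inr (j, k)) +m v') = img v.
Proof.
move=> uv.
have : (0 < img v (val k))%N.
  by rewrite -uv mnm_combD img_tvar !mnmDE !mnm1E eqxx; lia.
case/img_gt0 => t [v1 [vE]] /tvar_exp_gt0_pole[i tE]; subst t v.
have [ij|ij] := eqVneq i j.
  by exists v1; rewrite ij; split=> //; exact: binomial_in_refl.
(* Since i differs from j, the variable x_j comes from the rest v1 of v. *)
have : (0 < img v1 (val j))%N.
  have /mnmP /(_ (val j)) := uv; rewrite !mnm_combD !img_tvar/= !mnmDE !mnm1E.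
  rewrite eqxx (inj_eq val_inj) (negbTE ij).
  have /negbTE -> : val k != val j; last by lia.
  have jp : (val j < p)%N := valP j; have kpq : (p <= val k < q)%N := valP k.
  by apply: contraTneq kpq => ->; lia.
case/img_gt0 => t [v2 [vE]] /tvar_exp_gt0_zero[tE|[m tE]]; subst t v1.
- exists (U (inl (inl i)) +m v2); split; last first.
    by apply/mnmP => x; rewrite !mnm_combD !img_tvar/= !mnmDE; lia.
  rewrite !addmA; apply: binomial_inDr => //.
  rewrite (addmC (U (inr (i, k)))) (addmC (U (inr (j, k)))).
  by rewrite /binomial_in !mpolyXD; apply: I_rel; left; exists j, i, k.
- exists (U (inr (i, m)) +m v2); split; last first.
    by apply/mnmP => x; rewrite !mnm_combD !img_tvar/= !mnmDE; lia.
  rewrite !addmA; apply: binomial_inDr => //; apply: binomial_in_sym => //.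
  rewrite (addmC (U (inr (i, k)))).
  by rewrite /binomial_in !mpolyXD; apply: I_rel; right; exists j, i, k, m.
Qed.

(** Two monomials with the same image become multiples of a common variable
after rewriting by the relations. Pair variables have to be tried first, on
either side: without them the image determines the variables. *)
Lemma common_variable u v : img u = img v -> u <> mnm0 ->
  exists (t : tvar) u' v',
    [/\ binomial_in I u (U t +m u'), binomial_in I v (U t +m v'),
        img (U t +m u') = img u & img (U t +m v') = img v].
Proof.
move=> uv u0.
have refl := binomial_in_refl I_ideal.
have [[j [k [u' uE]]]|nopair_u] :=
    pselect (exists j k u', u = U (inr (j, k)) +m u').
  have [v' [vv' imgv]] : exists v', binomial_in I v (U (inr (j, k)) +m v') /\
      img (U (inr (j, k)) +m v') = img v by apply: (pair_exchange (u := u')); rewrite -uv uE.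
  by subst u; exists (inr (j, k)), u', v'; split.
have [[j [k [v' vE]]]|nopair_v] :=
    pselect (exists j k v', v = U (inr (j, k)) +m v').
  have [u' [uu' imgu]] : exists u', binomial_in I u (U (inr (j, k)) +m u') /\
      img (U (inr (j, k)) +m u') = img u.
    by apply: (pair_exchange (u := v')); rewrite uv vE.
  by subst v; exists (inr (j, k)), u', v'; split.
have [i ui] := mnm_neq0 u0.
have [u' uE] := mnm1_split ui.
have {}uE : u = U (enum_val i) +m u' by rewrite enum_valK.
suff [v' vE] : exists v', v = U (enum_val i) +m v'.
  by exists (enum_val i), u', v'; rewrite -uE -vE; split.
move: (enum_val i) uE => [[j|j]|[j k]] uE; last first.
- by case: nopair_u; exists j, k, u'.
- have : (0 < img v (val j))%N.
    by rewrite -uv uE mnm_combD img_tvar mnmDE mnm1E eqxx.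
  case/img_gt0 => t [v' [vE]] /tvar_exp_gt0_unit tE.
  by exists v'; rewrite -tE.
- have : (0 < img v (val j))%N.
    by rewrite -uv uE mnm_combD img_tvar mnmDE mnm1E eqxx.
  case/img_gt0 => t [v' [vE]] /tvar_exp_gt0_zero[tE|[k tE]].
    by exists v'; rewrite -tE.
  by case: nopair_v; exists j, k, v'; rewrite -tE.
Qed.

Lemma mdeg_tvar_exp_gt0 v : (0 < mdeg (tvar_exp v))%N.
Proof. by case: v => [[j|j]|[j k]]; rewrite /= ?mdegD !mdeg1. Qed.

Lemma img_eq0 u : img u = mnm0 -> u = mnm0.
Proof.
move=> u0; apply: contrapT => /mnm_neq0[i ui].
have [u' uE] := mnm1_split ui.
have := congr1 mdeg u0.
rewrite uE mnm_combD mdegD mnm_comb1 mdeg0.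
by have := mdeg_tvar_exp_gt0 (enum_val i); rewrite -/(tidx_exp i); lia.
Qed.

(** Induction on the degree of the image, cancelling a common variable. *)
Lemma toric_binomials u v : img u = img v -> binomial_in I u v.
Proof.
have [d] := ubnP (mdeg (img u)); elim: d u v => // d IHd u v ud uv.
have [u0|u0] := pselect (u = mnm0).
  move: uv; rewrite u0 mnm_comb0 => /esym /img_eq0 ->.
  exact: binomial_in_refl.
have [t [u' [v' [uu' vv' imgu imgv]]]] := common_variable uv u0.
apply: (binomial_in_trans I_ideal uu').
apply: (binomial_in_trans I_ideal _ (binomial_in_sym I_ideal vv')).
apply: binomial_inDl => //; apply: IHd.
  rewrite -imgu mnm_combD mdegD img_tvar in ud.
  by have := mdeg_tvar_exp_gt0 t; lia.
by apply: (@mnm_addI _ (img (U t))); rewrite -!mnm_combD imgu imgv.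
Qed.

End ToricIdeal.

(** * Exponents of nonnegative weight *)
Section HolomorphyMonoid.
Variable l : 'I_r -> int.
Hypotheses (l_zero : forall j : 'I_r, (j < p)%N -> l j = 1)
  (l_pole : forall j : 'I_r, (p <= j < q)%N -> l j = -1)
  (l_unit : forall j : 'I_r, (q <= j)%N -> l j = 0).

(** The order at s0 of the product of the f_j ^ a_j, when l_j is the order
of f_j. *)
Definition weight (a : multinom r) : int := \sum_j (a j)%:Z * l j.

Lemma weight0 : weight mnm0 = 0.
Proof. by rewrite /weight big1// => j _; rewrite mnm0E mul0r. Qed.

Lemma weightD a b : weight (a +m b) = weight a + weight b.
Proof.
rewrite /weight -big_split; apply: eq_bigr => j _.
by rewrite mnmDE PoszD mulrDl.
Qed.

Lemma weight1 j : weight (mnm1 j) = l j.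
Proof.
rewrite /weight (bigD1 j)//= mnm1E eqxx mul1r big1 ?addr0// => i ij.
by rewrite mnm1E eq_sym (negbTE ij) mul0r.
Qed.

Lemma submonoid_weight : is_submonoid [set a | 0 <= weight a].
Proof.
split=> [|a b /= a0 b0]; first by rewrite /= weight0.
by rewrite weightD addr_ge0.
Qed.

Lemma weight_tvar_exp v : 0 <= weight (tvar_exp v).
Proof.
case: v => [[j|j]|[j k]] /=; rewrite ?weightD !weight1.
- by rewrite l_zero// (valP j).
- by rewrite l_unit// (valP j).
- by rewrite (l_zero (valP j)) (l_pole (valP k)) subrr.
Qed.

(** The only possible splitting to exclude is that of x_j x_k into two single
variables: one of them would be the pole x_k, of weight -1. *)
Lemma irreducible_tvar_exp v :
  is_irreducible [set a | 0 <= weight a] (tvar_exp v).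
Proof.
have mdeg_eq1 (a : multinom r) : mdeg a = 1%N -> exists i, a = mnm1 i.
  by move=> /eqP /mdeg1P [i /eqP ->]; exists i.
split=> [||a b /= a0 b0 abE]; first exact: weight_tvar_exp.
  by have := mdeg_tvar_exp_gt0 v => + v0; rewrite v0 mdeg0.
suff : mdeg a = 0%N \/ mdeg b = 0%N.
  by case=> /eqP; rewrite mdeg_eq0 => /eqP; [left|right].
have := congr1 mdeg abE; rewrite mdegD.
case: v abE => [[j|j]|[j k]] /= abE; rewrite ?mdegD !mdeg1; try lia.
move=> ab2; apply: contrapT => ab_n0.
have [x aE] : exists i, a = mnm1 i by apply: mdeg_eq1; lia.
have [y bE] : exists i, b = mnm1 i by apply: mdeg_eq1; lia.
have lk : l (val k) = -1 by rewrite l_pole ?(valP k).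
have /mnmP /(_ (val k)) := abE; rewrite !mnmDE aE bE !mnm1E eqxx.
rewrite aE weight1 in a0; rewrite bE weight1 in b0.
case: (x =P _) => [xk|_]; first by rewrite xk lk in a0.
by case: (y =P _) => [yk|_]; [rewrite yk lk in b0|lia].
Qed.

(** The exponents of nonnegative weight are the sums of generators. *)
Lemma range_img : range img = [set a | 0 <= weight a].
Proof.
apply/seteqP; split=> [_ [u _ <-] /=|a /=].
  have [d] := ubnP (mdeg u); elim: d u => // d IHd u ud.
  have [->|/mnm_neq0[i ui]] := pselect (u = mnm0).
    by rewrite mnm_comb0 weight0.
  have [u' uE] := mnm1_split ui.
  rewrite uE mnm_combD weightD mnm_comb1 addr_ge0//.
    exact: weight_tvar_exp.
  by apply: IHd; rewrite uE mdegD mdeg1 in ud; lia.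
have [d] := ubnP (mdeg a); elim: d a => // d IHd a ad a0.
have step t a' : a = tvar_exp t +m a' -> 0 <= weight a' -> range img a.
  move=> aE a'0; have [|//|u _ ua'] := IHd a'.
    by rewrite aE mdegD in ad; have := mdeg_tvar_exp_gt0 t; lia.
  by exists (U t +m u) => //; rewrite mnm_combD img_tvar ua' aE.
have [[j [jq aj]]|nounit] := pselect (exists j : 'I_r, (q <= j)%N /\ (0 < a j)%N).
  have [a' aE] := mnm1_split aj.
  apply: (step (inl (inr (Sub j jq))) a') => //=.
  by move: a0; rewrite aE weightD weight1 (l_unit jq) add0r.
have [[k [kpq ak]]|nopole] :=
    pselect (exists k : 'I_r, (p <= k < q)%N /\ (0 < a k)%N).
  have [a1 aE] := mnm1_split ak.
  have [[j [jp aj]]|nozero] := pselect (exists j : 'I_r, (j < p)%N /\ (0 < a1 j)%N).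
    have [a2 a1E] := mnm1_split aj.
    apply: (step (inr (Sub j jp, Sub k kpq)) a2) => /=.
      by rewrite aE a1E; apply/mnmP => x; rewrite !mnmDE; lia.
    move: a0; rewrite aE a1E !weightD !weight1 (l_zero jp) (l_pole kpq); lia.
  (* Without zeros the rest a1 has weight at most 0, so a has weight < 0. *)
  have : weight a1 <= 0.
    apply: sumr_le0 => j _; have [jp|pj] := ltnP j p.
      have -> : a1 j = 0%N by apply: contrapT => a1j; apply: nozero; exists j; lia.
      by rewrite mul0r.
    have [jq|qj] := ltnP j q; last by rewrite l_unit// mulr0.
    by rewrite l_pole ?pj ?jq//; lia.
  by move: a0; rewrite aE weightD weight1 (l_pole kpq); lia.
have [->|/mnm_neq0[j aj]] := pselect (a = mnm0).
  by exists mnm0; rewrite ?mnm_comb0.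
(* Only zeros are left, so removing one keeps the weight nonnegative. *)
have jp : (j < p)%N.
  rewrite ltnNge; apply/negP => pj; have [jq|qj] := ltnP j q.
    by apply: nopole; exists j; rewrite pj jq.
  by apply: nounit; exists j.
have [a' aE] := mnm1_split aj.
apply: (step (inl (inl (Sub j jp))) a') => //=.
apply: sumr_ge0 => i _; have [ip|pi] := ltnP i p; first by rewrite l_zero// mulr1.
suff -> : a' i = 0%N by rewrite mul0r.
have : a i = 0%N.
  apply: contrapT => ai; have [iq|qi] := ltnP i q.
    by apply: nopole; exists i; rewrite pi iq; split=> //; lia.
  by apply: nounit; exists i; split=> //; lia.
by rewrite aE mnmDE; lia.
Qed.

End HolomorphyMonoid.

End ToricVariables.

(** * The morphism Phi *)

Section PhiTheory.
Context {F : fieldType} {p q r : nat}.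

Lemma tvar_imageE (v : tvar p q r) : tvar_image F v = mpolyX F (tvar_exp v).
Proof. by case: v => [[j|j]|[j k]] //=; rewrite mpolyXD. Qed.

Lemma Phi_var i : Phi F p q r (mvar F i) = mpolyX F (tidx_exp i).
Proof. by rewrite /Phi/= comp_mpolyXU -tnth_nth tnth_mktuple tvar_imageE. Qed.

Lemma Phi_zero j : Phi F p q r (t_zero F j) = mvar F (val j).
Proof. by rewrite Phi_var /tidx_exp enum_rankK. Qed.

Lemma Phi_pair j k :
  Phi F p q r (t_pair F j k) = mvar F (val j) * mvar F (val k).
Proof. by rewrite Phi_var /tidx_exp enum_rankK /= mpolyXD. Qed.

Lemma ker_Phi : (p <= q)%N ->
  mpoly_ker (Phi F p q r) = gen_ideal (toric_relations F p q r).
Proof.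
move=> le_pq; apply/seteqP; split.
  apply: (monomial_morphism_ker_sub Phi_var); first exact: gen_ideal_ideal.
  move=> u v uv; apply: (toric_binomials le_pq (gen_ideal_ideal _) _ uv).
  exact: sub_gen_smallest.
apply: smallest_sub.
  split=> [|a u v]; rewrite /mpoly_ker /=; first exact: raddf0.
  by move=> u0 v0; rewrite rmorphD rmorphM/= u0 v0 mulr0 addr0.
move=> _ [[j [i [k ->]]]|[j [i [k [m ->]]]]]; rewrite /mpoly_ker /=.
  rewrite rmorphB !rmorphM/= !Phi_zero !Phi_pair.
  by apply/eqP; rewrite subr_eq0 mulrCA.
rewrite rmorphB !rmorphM/= !Phi_pair.
by apply/eqP; rewrite subr_eq0 mulrACA [X in _ * X]mulrC mulrACA.
Qed.

Lemma tvar_monomials :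
  mpolyX F @` range (@tvar_exp p q r) =
    ([set mvar F j | j in [set j : 'I_r | (j < p)%N]] `|`
     [set mvar F j | j in [set j : 'I_r | (q <= j)%N]] `|`
     [set P | exists j k : 'I_r, [/\ (j < p)%N, (p <= k < q)%N &
                P = mvar F j * mvar F k]]).
Proof.
apply/seteqP; split=> [_ [_ [v _ <-] <-]|P].
  case: v => [[j|j]|[j k]] /=.
  - by left; left; exists (val j) => //; exact: valP j.
  - by left; right; exists (val j) => //; exact: valP j.
  - right; exists (val j), (val k).
    by split; [exact: valP j|exact: valP k|rewrite mpolyXD].
case=> [[[j jp <-]|[j qj <-]]|[j [k [jp kpq ->]]]].
- by exists (mnm1 j) => //; exists (inl (inl (Sub j jp))).
- by exists (mnm1 j) => //; exists (inl (inr (Sub j qj))).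
- exists (mnm1 j +m mnm1 k); last by rewrite mpolyXD.
  by exists (inr (Sub j jp, Sub k kpq)).
Qed.

End PhiTheory.

Unset Implicit Arguments.

Theorem theorem1p13 (R : realType) (K : splittingFieldType rat)
    (KQ : galois 1%AS {:K})
    (r : nat) (chi : 'I_r -> gal_of {:K} -> R[i]) (chiP : irr_characters chi)
    (f : 'I_r -> CC R -> CC R) (fP : forall j, artin_L_function (chi j) (f j))
    (s0 : CC R) (s0_neq1 : s0 != 1)
    (l : 'I_r -> int) (lP : forall j, order_at (f j) s0 (l j))
    (F : fieldType) (ev : F -> CC R -> CC R) (FP : field_of_mero_lt1 ev)
    (l_simple : forall j, [\/ l j = -1, l j = 0 | l j = 1])
    (not_artin : ~ forall j, holomorphic_at (f j) s0)
    (p q : nat) (p_ge1 : (1 <= p)%N) (lt_pq : (p < q)%N) (le_qr : (q <= r)%N)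
    (l_pos : forall j : 'I_r, (j < p)%N -> 0 < l j)
    (l_neg : forall j : 'I_r, (p <= j < q)%N -> l j < 0)
    (l_0 : forall j : 'I_r, (q <= j)%N -> l j = 0) :
  monoid_algebra F (hol_monoid f s0) =
    gen_subalg ([set mvar F j | j in [set j : 'I_r | (j < p)%N]] `|`
                [set mvar F j | j in [set j : 'I_r | (q <= j)%N]] `|`
                [set P | exists j k : 'I_r, [/\ (j < p)%N, (p <= k < q)%N &
                           P = mvar F j * mvar F k]])
  /\ [/\ toric_epimorphism (hol_monoid f s0) (Phi F p q r),
         toric_ideal (hol_monoid f s0) (mpoly_ker (Phi F p q r)) &
         mpoly_ker (Phi F p q r) = gen_ideal (toric_relations F p q r)].
Proof.
have le_pq := ltnW lt_pq.
have l_zero (j : 'I_r) : (j < p)%N -> l j = 1.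
  by move=> /l_pos; case: (l_simple j) => ->.
have l_pole (j : 'I_r) : (p <= j < q)%N -> l j = -1.
  by move=> /l_neg; case: (l_simple j) => ->.
have HE : hol_monoid f s0 = [set a | 0 <= weight l a] := hol_monoidE lP.
have rangeE := range_img le_pq l_zero l_pole l_0.
have rangePhi : range (Phi F p q r) = monoid_algebra F (hol_monoid f s0).
  by rewrite (range_monomial_morphism Phi_var) rangeE HE.
have genPhi : monoid_algebra F (hol_monoid f s0) =
    gen_subalg (mpolyX F @` range (@tvar_exp p q r)).
  by rewrite -rangePhi (range_monomial_morphism_gen Phi_var) range_tidx_exp.
have epi : toric_epimorphism (hol_monoid f s0) (Phi F p q r).
  split=> //; exists tidx_exp; split; first exact: tidx_exp_inj.
    exact: Phi_var.
  rewrite range_tidx_exp HE; apply: minimal_generators_irreducible.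
  - exact: submonoid_weight.
  - by move=> _ [v _ <-]; exact: irreducible_tvar_exp.
  - by rewrite -genPhi HE.
split; first by rewrite genPhi tvar_monomials.
split=> //; last exact: ker_Phi.
by exists (Phi F p q r).
Qed.
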